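(* Let $p$ be a prime and $n$ a positive integer such that $p^2\mid n$. Let $\Phi_n(x)=\sum_{k=0}^{\varphi(n)}a_n(k)x^k$ be the $n$-th cyclotomic polynomial. Then $a_n(k)=0$ whenever $p\nmid k$.
   Context: $\varphi$ denotes Euler's totient function; $a_n(k)$ is the coefficient of $x^k$ in $\Phi_n(x)$. *)

(* Defs.v *)
From mathcomp Require Export all_boot all_order all_algebra all_field.
Export GRing.Theory.

(* Main.v *)
(** If [z] is a primitive [n]-th root of unity and [w = z ^ (n / p)], then [w]
    has order [p]. Since [p^2 | n], the numbers [n] and [n / p] have the same
    prime divisors, so multiplication by [w] permutes the primitive [n]-th roots
    of unity. Hence [Phi_n (w x) = c Phi_n x] for a constant [c], and [c = 1]
    because [Phi_n 0 <> 0]. Comparing coefficients, [(w ^ k - 1) a_n(k) = 0]. *)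
Require Import Defs.
From mathcomp Require Import all_boot all_order all_algebra all_field.

Local Open Scope ring_scope.

Lemma coprimeMr_dvd (p m x : nat) :
  (p %| m)%N -> coprime x (p * m) = coprime x m.
Proof.
move=> p_m; rewrite coprimeMr; case: (boolP (coprime x m)) => [co|_].
  by rewrite (coprime_dvdr p_m co).
by rewrite andbF.
Qed.

Lemma coef_comp_polyZX (R : comNzRingType) (q : {poly R}) (w : R) (k : nat) :
  (q \Po (w *: 'X))`_k = w ^+ k * q`_k.
Proof.
rewrite comp_polyE coef_sum.
under eq_bigr => i _ do rewrite exprZn !coefZ coefXn.
have [k_lt | k_ge] := ltnP k (size q).
  rewrite (bigD1 (Ordinal k_lt)) //= eqxx mulr1 big1 ?addr0 1?mulrC // => i.
  by rewrite -val_eqE eq_sym /= => /negPf ->; rewrite !mulr0.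
rewrite nth_default // mulr0 big1 // => i _.
by rewrite gtn_eqF ?mulr0 // (leq_trans (ltn_ord i)).
Qed.

Lemma cyclotomic_comp_polyZX (F : fieldType) (p m : nat) (z : F) :
    (p * m)%N.-primitive_root z -> (p %| m)%N ->
  cyclotomic z (p * m) \Po (z ^+ m *: 'X) = cyclotomic z (p * m).
Proof.
move=> prim_z p_m; set n := (p * m)%N; set w := z ^+ m.
have n_gt0 : (0 < n)%N := prim_order_gt0 prim_z.
(* Since [w * z ^+ k = z ^+ (k + m)], multiplication by [w] acts on exponents as the shift by [m]
   modulo [n]. *)
pose f (k : 'I_n) := Ordinal (ltn_pmod (k + m) n_gt0).
have f_inj : injective f.
  move=> i j /(congr1 val) /= /eqP; rewrite eqn_modDr !modn_small //.
  by move/eqP/val_inj.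
have [c Dc] : exists c, cyclotomic z n \Po (w *: 'X) = c *: cyclotomic z n.
  (* Substituting [w *: 'X] in the factor of index [f k] gives [w] times the factor of index [k]. *)
  exists (\prod_(k < n | coprime k n) w).
  rewrite {1}/cyclotomic rmorph_prod /= (reindex_inj f_inj) -scaler_prod.
  apply: eq_big => [k | k _] /=.
    (* As [p %| m], being coprime to [n] means being coprime to [m], which the shift by [m]
       preserves. *)
    rewrite coprime_modl !coprimeMr_dvd // ![coprime _ m]coprime_sym.
    by rewrite /coprime gcdnDr.
  rewrite comp_polyB comp_polyX comp_polyC prim_expr_mod // exprD mulrC.
  by rewrite -/w polyCM mul_polyC scalerBr.
have a0_neq0 : (cyclotomic z n)`_0 != 0.
  rewrite -horner_coef0 -[_ == 0]/(root _ _) root_cyclotomic //.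
  apply/negP => prim_0; have := prim_root_eq0 prim_0.
  by rewrite eqxx eqn0Ngt n_gt0.
have := congr1 (fun q : {poly F} => q`_0) Dc.
rewrite /= coef_comp_polyZX expr0 coefZ => /(mulIf a0_neq0) c1.
by rewrite Dc -c1 scale1r.
Qed.

Theorem corollary2p8 (p n : nat) (p_prime : prime p) (n_gt0 : (0 < n)%N)
    (p2_dvd_n : (p ^ 2 %| n)%N) (k : nat) (pNdvd_k : ~~ (p %| k)%N) :
  ('Phi_n)`_k = 0.
Proof.
have [m p_m Dn] : exists2 m, (p %| m)%N & n = (p * m)%N.
  have /dvdnP [q ->] := p2_dvd_n.
  by exists (p * q)%N; rewrite ?dvdn_mulr // mulnC -mulnA.
have [z prim_z] := C_prim_root_exists n_gt0.
(* [z] has order [p * m], so [z ^+ (m * k) = 1] would force [p %| k]. *)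
have wk_neq1 : (z ^+ m) ^+ k != 1.
  rewrite -exprM -(prim_order_dvd prim_z) Dn mulnC dvdn_pmul2l //.
  by move: n_gt0; rewrite Dn muln_gt0 => /andP[].
(* Over [algC] the integer polynomial ['Phi_n] splits as [cyclotomic z n]. *)
apply: (@intr_inj algC); rewrite -coef_map /= (Cintr_Cyclotomic prim_z).
rewrite Dn in prim_z *.
have := cyclotomic_comp_polyZX _ _ _ _ prim_z p_m.
move/(congr1 (fun q : {poly algC} => q`_k)); rewrite /= coef_comp_polyZX.
move/eqP; rewrite -subr_eq0 -{2}[_`_k]mul1r -mulrBl mulf_eq0 subr_eq0.
by rewrite (negPf wk_neq1) => /eqP.
Qed.
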